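(* Assume that $\Omega$ is finitely connected at $x_0\in\partial\Omega$. Let $A_k\subsetneq\Omega$, $k=1,2,\ldots$, be such that $A_{k+1}\subset A_k$, $x_0\in\overline{A}_k$ and $\operatorname{dist}(x_0,\Omega\cap\partial A_k)>0$ for each $k=1,2,\ldots$. Furthermore, let $\{r_k\}_{k=1}^\infty$ be a sequence strictly decreasing to zero with $0<r_k<\operatorname{dist}(x_0,\Omega\cap\partial A_k)$ for each $k$. Then there exists a prime end $[F_k]$ of $\Omega$ such that $I[F_k]=\{x_0\}$, $F_k=G_{j_k}(r_k)$ for some $1\le j_k\le N(r_k)$, and $F_k\subset A_k$, $k=1,2,\ldots$.
   Context: Setting: $(X,d,\mu)$ is a metric measure space with more than one point, $\mu$ is a Borel measure with $0<\mu(B)<\infty$ for all balls $B$, and $1\le p<\infty$ is fixed. $X$ is complete, $\mu$ is doubling (there is $C_\mu>0$ with $\mu(B(x,2r))\le C_\mu\mu(B(x,r))$ for all balls), and $X$ supports a $p$-Poincaré inequality: there are $C_{PI}>0$, $\lambda\ge1$ such that for all balls $B$ and all $u\in N^{1,p}(X)$, $\frac{1}{\mu(B)}\int_B|u-u_B|\,d\mu\le C_{PI}\operatorname{diam}(B)\bigl(\frac{1}{\mu(\lambda B)}\int_{\lambda B}g_u^p\,d\mu\bigr)^{1/p}$, where $u_B=\frac{1}{\mu(B)}\int_B u\,d\mu$. Here a nonnegative Borel function $g$ is an upper gradient of $u:X\to[-\infty,\infty]$ if for every nonconstant rectifiable curve $\gamma:[0,l_\gamma]\to X$ parameterized by arc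 length, $|u(\gamma(0))-u(\gamma(l_\gamma))|\le\int_\gamma g\,ds$ when both values are finite, and $\int_\gamma g\,ds=\infty$ otherwise; $N^{1,p}(X)$ is the space of measurable $u$ with $\int_X|u|^p\,d\mu+\inf_g\int_X g^p\,d\mu<\infty$ (infimum over upper gradients $g$ of $u$), and $g_u$ is the minimal $p$-weak upper gradient of $u$ (the a.e.-smallest $L^p$ function satisfying the upper gradient inequality for all curves except a family $\Gamma$ for which some nonnegative Borel $\rho\in L^p(X)$ has $\int_\gamma\rho\,ds=\infty$ for all $\gamma\in\Gamma$). $\Omega\subsetneq X$ is a bounded domain (bounded nonempty connected open set); closures and boundaries of subsets of $\Omega$ are taken in $X$. Ends: A bounded connected set $E\subsetneq\Omega$ is acceptable if $\overline E\cap\partial\Omega\ne\varnothing$. A sequence $\{E_k\}_{k=1}^\infty$ of acceptable sets is a chain if (i) $E_{k+1}\subset E_k$ for all $k$; (ii) $\operatorname{dist}(\Omega\cap\partial E_{k+1},\Omega\cap\partial E_k)>0$ for all $k$; (iii) the impression $\bigcap_{k=1}^\infty\overline{E}_k$ is contained in $\partial\Omega$. A chain $\{E_k\}$ divides a chain $\{F_k\}$ if for each $k$ there is $l$ with $E_l\subset F_k$. Two chains are equivalent if they divide each other; an end $[E_k]$ is an equivalence class of chains, and its impression $I[E_k]$ is the impression of any representative chain. Division is well defined between ends. A prime end is an end that is not divisible by any other end. Finite connectedness: $\Omega$ is finitely connected at $x_0\in\partial\Omega$ if for every $r>0$ there is an open set $G\subset X$ with $x_0\in G\subset B(x_0,r)$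 such that $G\cap\Omega$ has only finitely many components. For $r>0$, $\{G_j(r)\}_{j=1}^{N(r)}$ denotes the family of those components of $B(x_0,r)\cap\Omega$ which have $x_0$ in their closure ($N(r)$ is a nonnegative integer or $\infty$). *)

(* Defs.v *)
From HB Require Import structures.
From mathcomp Require Import all_boot all_order all_algebra.
From mathcomp Require Import all_classical all_reals all_analysis.
From mathcomp Require Import measurable_realfun.

Set Implicit Arguments.
Unset Strict Implicit.
Unset Printing Implicit Defensive.

Import Order.TTheory GRing.Theory Num.Theory.
Import numFieldNormedType.Exports.

Local Open Scope classical_set_scope.
Local Open Scope ring_scope.
Local Open Scope ereal_scope.

(* The library has [completeType] and [metricType] but not their join. Complete
   spaces carry a base point there; it plays no role below, as the spaces
   considered have at least two points. *)
#[short(type="completeMetricType")]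
HB.structure Definition CompleteMetric (K : numDomainType) :=
  {T of Complete T & Metric K T}.

Section metric_notions.
Context {R : realType} {X : metricType R}.
Implicit Types A B : set X.

Definition bounded_subset A := exists (x : X) (r : R), A `<=` ball x r.

Definition boundary A : set X := closure A `\` interior A.

(* [+oo] as soon as one of the two sets is empty. *)
Definition set_dist A B : \bar R :=
  ereal_inf [set (mdist x y)%:E | x in A & y in B].

Definition diam A : \bar R :=
  ereal_sup [set (mdist x y)%:E | x in A & y in A].

Definition components A : set (set X) := connected_component A @` A.

(* [s] lists the points of the partition other than [a], as in the library's
   [variation] for real-valued functions. *)
Definition curve_variation (a b : R) (gam : R -> X) (s : seq R) : R :=
  \sum_(0 <= n < size s)
    mdist (gam (nth b (a :: s) n)) (gam (nth b (a :: s) n.+1)).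

Definition curve_length (a b : R) (gam : R -> X) : \bar R :=
  ereal_sup [set (curve_variation a b gam s)%:E | s in itv_partition a b].

(* A curve [0, l] -> X is given by [l] and a function on the whole line whose
   values outside [0, l] are irrelevant. *)
Definition arclength_curve (l : R) (gam : R -> X) : Prop :=
  [/\ (0 <= l)%R, {within `[0%R, l], continuous gam} &
      forall s t : R, (0 <= s)%R -> (s <= t)%R -> (t <= l)%R ->
        curve_length s t gam = (t - s)%:E].

Definition nonconstant_curve (l : R) (gam : R -> X) : Prop :=
  exists s t : R, [/\ `[0%R, l]%classic s, `[0%R, l]%classic t &
                      gam s <> gam t].

Definition curve_integral (l : R) (gam : R -> X) (g : X -> \bar R) : \bar R :=
  \int[lebesgue_measure]_(t in `[0%R, l]) g (gam t).

Definition upper_gradient_ineq (u g : X -> \bar R) (l : R) (gam : R -> X) : Prop :=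
  if (u (gam 0%R) \is a fin_num) && (u (gam l) \is a fin_num)
  then (`|u (gam 0%R) - u (gam l)| <= curve_integral l gam g : Prop)
  else curve_integral l gam g = +oo.

End metric_notions.

Notation borel X := (g_sigma_algebraType (@open X)).

Section sobolev.
Context {R : realType} {X : completeMetricType R}.
Variable mu : {measure set (borel X) -> \bar R}.
Variable p : R.
Implicit Types u g rho : borel X -> \bar R.

Definition nonneg_borel g : Prop :=
  (forall x, 0 <= g x) /\ measurable_fun setT g.

Definition upper_gradient u g : Prop :=
  nonneg_borel g /\
  forall (l : R) (gam : R -> X), arclength_curve l gam ->
    nonconstant_curve l gam -> upper_gradient_ineq u g l gam.

Definition p_energy g : \bar R := \int[mu]_x (g x `^ p).

Definition newtonian u : Prop :=
  measurable_fun setT u /\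
  \int[mu]_x (`|u x| `^ p) + ereal_inf (p_energy @` upper_gradient u) < +oo.

Definition exceptional_family (Gam : R -> (R -> X) -> Prop) : Prop :=
  exists rho, [/\ nonneg_borel rho, p_energy rho < +oo &
    forall (l : R) (gam : R -> X), Gam l gam ->
      curve_integral l gam rho = +oo].

Definition weak_upper_gradient u g : Prop :=
  nonneg_borel g /\
  exists2 Gam, exceptional_family Gam &
    forall (l : R) (gam : R -> X), arclength_curve l gam ->
      nonconstant_curve l gam -> ~ Gam l gam -> upper_gradient_ineq u g l gam.

Definition minimal_weak_upper_gradient u g : Prop :=
  [/\ weak_upper_gradient u g, p_energy g < +oo &
      forall h, weak_upper_gradient u h -> p_energy h < +oo ->
        {ae mu, forall x, g x <= h x}].

Definition mean (B : set (borel X)) u : \bar R :=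
  ((fine (mu B))^-1)%:E * \int[mu]_(x in B) u x.

Definition doubling : Prop :=
  exists2 C : R, (0 < C)%R &
    forall (x : X) (r : R), (0 < r)%R ->
      mu (ball x (2 * r)) <= C%:E * mu (ball x r).

(* Every [u] in the Newtonian space has a minimal weak upper gradient, unique up
   to null sets: quantifying [gu] existentially or universally is the same. *)
Definition poincare : Prop :=
  exists C lam : R, [/\ (0 < C)%R, (1 <= lam)%R &
    forall (x : X) (r : R), (0 < r)%R ->
    forall u, newtonian u ->
      exists2 gu, minimal_weak_upper_gradient u gu &
        mean (ball x r) (fun y => `|u y - mean (ball x r) u|) <=
        C%:E * diam (ball x r) *
          (mean (ball x (lam * r)) (fun y => gu y `^ p)) `^ p^-1].

End sobolev.

Section prime_ends.
Context {R : realType} {X : metricType R}.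
Variable Om : set X.
Implicit Types E F : nat -> set X.

Definition bounded_domain : Prop :=
  [/\ bounded_subset Om, Om !=set0, connected Om & open Om].

Definition acceptable (E : set X) : Prop :=
  [/\ bounded_subset E, connected E, E `<` Om &
      (closure E `&` boundary Om) !=set0].

Definition impression E : set X := \bigcap_k closure (E k).

(* Sequences are indexed from 0 instead of 1. *)
Definition chain E : Prop :=
  [/\ forall k, acceptable (E k),
      forall k, E k.+1 `<=` E k,
      forall k, 0 < set_dist (Om `&` boundary (E k.+1)) (Om `&` boundary (E k))
    & impression E `<=` boundary Om].

Definition divides E F : Prop := forall k, exists l, E l `<=` F k.

Definition equivalent_chains E F : Prop := divides E F /\ divides F E.

Definition end_class E : set (nat -> set X) :=
  [set F | chain F /\ equivalent_chains E F].

Definition is_end (e : set (nat -> set X)) : Prop :=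
  exists2 E, chain E & e = end_class E.

Definition end_divides (e f : set (nat -> set X)) : Prop :=
  forall E F, e E -> f F -> divides E F.

Definition prime_end (e : set (nat -> set X)) : Prop :=
  is_end e /\ forall f, is_end f -> end_divides f e -> f = e.

Definition finitely_connected_at (x0 : X) : Prop :=
  forall r : R, (0 < r)%R -> exists G : set X,
    [/\ open G, G x0, G `<=` ball x0 r & finite_set (components (G `&` Om))].

(* The G_j(r), 1 <= j <= N(r), as an unindexed family. *)
Definition components_at (x0 : X) (r : R) : set (set X) :=
  [set C | components (ball x0 r `&` Om) C /\ closure C x0].

End prime_ends.

(* Main.v *)
(* A Poincare inequality forbids disconnecting a ball: if V and W are disjoint open
   sets covering B(x, 4e), the function equal to the indicator of V times a cutoff
   has gradient zero on B(x, e), hence is a.e. constant on B(x, e / lambda), so this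
   smaller ball cannot meet both V and W. Therefore quasicomponents, and then
   components, of open sets are open, and the boundary in Om of a component of
   B(x0, r) /\ Om stays at distance at least r from x0.

   The F_k are selected simultaneously by an ultrafilter containing the A_k and the
   neighbourhoods of x0: finite connectedness puts exactly one component of
   B(x0, r_k) /\ Om in the ultrafilter, it meets A_k while avoiding its boundary,
   and two consecutive choices meet.

   The end is prime: if a chain E divides F but no F_l lies in E_k, then every F_l
   crosses the boundaries of both E_k and E_(k+1), which are therefore at distance
   zero because the F_l shrink to x0. *)

Require Import Defs.
From mathcomp Require Import all_boot all_order all_algebra finmap.
From mathcomp Require Import all_classical all_reals all_analysis.
From mathcomp Require Import measurable_realfun.
From mathcomp Require Import lra.

Set Implicit Arguments.
Unset Strict Implicit.
Unset Printing Implicit Defensive.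

Import Order.TTheory GRing.Theory Num.Theory.
Import numFieldNormedType.Exports.

Local Open Scope classical_set_scope.
Local Open Scope ring_scope.

(** * Boundary crossing by connected sets; ultrafilters and finite unions *)

(** If [C] misses the boundary of [A], then [interior A] and [closure A] have the same trace on [C],
    so the trace of [A] is clopen in [C]. *)
Lemma connected_meets_boundary (R : realType) (X : metricType R) (C A : set X) :
  connected C -> C `&` A !=set0 -> ~ C `<=` A -> C `&` boundary A !=set0.
Proof.
move=> cC CA nCA; apply: contrapT => /nonemptyPn C0; apply: nCA.
have nb z : C z -> closure A z -> interior A z.
  move=> Cz clz; apply: contrapT => niz.
  by have : (C `&` boundary A) z by []; rewrite C0.
apply/setIidPl/(cC _ CA).
- exists (interior A); first exact: open_interior.
  apply/seteqP; split => z [Cz Az]; split => //; last exact: interior_subset.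
  by apply: nb => //; exact: subset_closure.
- exists (closure A); first exact: closed_closure.
  apply/seteqP; split => z [Cz Az]; split => //; first exact: subset_closure.
  by apply: interior_subset; exact: nb.
Qed.

(** Otherwise [F] contains the complements of all the [B i], hence their finite intersection, which
    is disjoint from the union. *)
Lemma ultra_finite_bigcup (T : Type) (I : choiceType) (F : set_system T)
    (D : set I) (B : I -> set T) : UltraFilter F -> finite_set D ->
  F (\bigcup_(i in D) B i) -> exists2 i, D i & F (B i).
Proof.
move=> UF /finite_fsetP[D' ->] FB; apply: contrapT => nex.
have FC i : i \in D' -> F (~` B i).
  by move=> Di; have [FBi|//] := in_ultra_setVsetC (B i) UF; case: nex; exists i.
have FcapC : F (\bigcap_(i in [set` D']) ~` B i) by apply: filter_bigI.
have [x [[i Di Bix] /(_ _ Di)]] := filter_ex (filterI FB FcapC).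
by [].
Qed.

(** * Openness of the components of open sets *)

(** As [d] is chosen before [V] and [W], the quasicomponent of [x] in [ball x e] contains a whole
    ball. A Poincare inequality yields local connectedness in this form, since it excludes one
    splitting at a time. *)
Definition locally_quasiconnected (R : realType) (X : metricType R) : Prop :=
  forall (x : X) (e : R), 0 < e -> exists2 d, 0 < d &
    forall V W : set X, open V -> open W -> V `&` W = set0 ->
      ball x e `<=` V `|` W -> V x -> ball x d `<=` V.

(* The quasicomponents of an open set are open by hypothesis, hence clopen, hence
   connected; no compactness is needed to identify them with components. *)
Lemma open_connected_component (R : realType) (X : metricType R) (U : set X)
    (x : X) :
  locally_quasiconnected X -> open U -> open (connected_component U x).
Proof.
move=> lqc oU.
(* [Q y] is the quasicomponent of [y] in [U]. *)
pose Q y := [set z | U z /\ forall V W : set X, open V -> open W ->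
  V `&` W = set0 -> U = V `|` W -> V y -> V z].
have [dQ dQ0 QP] : exists2 d : X -> R, forall z, U z -> 0 < d z &
    forall y z, Q y z -> ball z (d z) `<=` Q y.
  have H z : exists d : R, U z -> 0 < d /\ (ball z d `<=` U) /\
      forall V W : set X, open V -> open W -> V `&` W = set0 -> U = V `|` W ->
      V z -> ball z d `<=` V.
    have [Uz|nUz] := pselect (U z); last by exists 0.
    have /nbhs_ballP[e /= e0 eU] : nbhs z U by apply: open_nbhs_nbhs.
    have [d d0 dV] := lqc z e e0.
    exists (Num.min d e) => _; split; first by rewrite lt_min d0.
    split.
      by apply: subset_trans eU; apply: le_ball; rewrite ge_min lexx orbT.
    move=> V W oV oW VW UVW Vz.
    apply: (@subset_trans _ (ball z d)); first by apply: le_ball; rewrite ge_min lexx.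
    by apply: (dV V W oV oW VW _ Vz); rewrite -UVW.
  have [d dP] := @choice _ _ _ H; exists d => [z /dP[]//|y z [Uz Qz] w zw].
  have [d0 [dU dV]] := dP _ Uz; split; first exact: dU.
  move=> V W oV oW VW UVW Vy.
  by apply: (dV V W oV oW VW UVW _ _ zw); exact: (Qz V W oV oW VW UVW Vy).
have Qopen y : open (Q y).
  rewrite openE => z Qz; apply/nbhs_ballP; exists (dQ z).
    by apply: dQ0; case: Qz.
  exact: QP.
(* A splitting that separates [z] from [y] separates the whole open piece [W] around [z] from
   [y]. *)
have UQopen y : open (U `\` Q y).
  rewrite openE => z [Uz nQz].
  have [V [W [oV oW VW UVW [Vy nVz]]]] : exists V W : set X,
      [/\ open V, open W, V `&` W = set0, U = V `|` W & V y /\ ~ V z].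
    apply: contrapT => nex; apply: nQz; split => // V W oV oW VW UVW Vy.
    by apply: contrapT => nVz; apply: nex; exists V, W.
  have Wz : W z by move: Uz; rewrite UVW => -[].
  apply: (@filterS _ _ _ W); last exact: open_nbhs_nbhs.
  move=> w Ww; split; first by rewrite UVW; right.
  move=> [_ /(_ V W oV oW VW UVW Vy) Vw].
  by have : (V `&` W) w by []; rewrite VW.
(* A clopen part [B] of [Q y] is clopen in [U], because [Q y] is; [B] and its complement then split
   [U], and no such splitting cuts [Q y]. *)
have Qcon y : U y -> connected (Q y).
  move=> Uy B [b Bb] [C oC BC] [D cD BD].
  have Qy : Q y y by split.
  have BQ : B `<=` Q y by rewrite BC; exact: subIsetl.
  have QU : Q y `<=` U by move=> ? [].
  have oB : open B by rewrite BC; apply: openI.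
  have oUB : open (U `\` B).
    suff -> : U `\` B = (U `\` Q y) `|` (Q y `&` ~` D).
      by apply: openU => //; apply: openI => //; exact: closed_openC.
    apply/seteqP; split => z.
      move=> [Uz nBz]; have [Qz|nQz] := pselect (Q y z); last by left.
      by right; split => // Dz; apply: nBz; rewrite BD.
    move=> [[Uz nQz]|[Qz nDz]]; split => //; first by move=> /BQ.
      exact: QU.
    by rewrite BD => -[].
  have BUB : B `&` (U `\` B) = set0.
    by rewrite setDE setIA setIAC setICr set0I.
  have UBE : U = B `|` (U `\` B).
    by rewrite setDUK// => z /BQ/QU.
  have [By|nBy] := pselect (B y).
    apply/seteqP; split => // z [_ Qz].
    exact: (Qz B (U `\` B) oB oUB BUB UBE By).
  have [_ Qb] := BQ _ Bb.
  have : (U `\` B) b.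
    by apply: (Qb (U `\` B) B) => //; [rewrite setIC|rewrite setUC].
  by case.
rewrite openE => z xz.
have Uz : U z by exact: connected_component_sub xz.
rewrite (same_connected_component xz).
apply: (@filterS _ _ _ (Q z)); last by apply: open_nbhs_nbhs; split; last by split.
by apply: connected_component_max; [split|move=> ? []|exact: Qcon].
Qed.

(** * Components of the domain near a boundary point *)

Section ultrafilter_at_boundary.
Context (R : realType) (X : metricType R).
Variables (Om : set X) (x0 : X) (U : set_system X).
Hypothesis U_ultra : UltraFilter U.
Hypothesis U_x0 : nbhs x0 `<=` U.

(** Finiteness is available only for the smaller set [G]: one of its finitely many components in
    [Om] belongs to [U], and so does the component of the ball that contains it. *)
Lemma ultra_component_at (rho : R) : 0 < rho -> U Om ->
  finitely_connected_at Om x0 ->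
  exists2 C, components_at Om x0 rho C & U C.
Proof.
move=> rho0 UOm /(_ _ rho0)[G [oG Gx0 GB fG]].
have UG : U (G `&` Om).
  by apply: filterI => //; apply: U_x0; exact: open_nbhs_nbhs.
have := UG; rewrite -[G `&` Om in X in U X]connected_component_cover.
move=> /(ultra_finite_bigcup U_ultra fG)[_ [y GOy <-] UD].
have GOB : G `&` Om `<=` ball x0 rho `&` Om.
  by move=> z [/GB ? ?].
have DC : connected_component (G `&` Om) y `<=`
    connected_component (ball x0 rho `&` Om) y.
  apply: connected_component_max; first exact: connected_component_refl.
    by apply: subset_trans GOB; exact: connected_component_sub.
  exact: component_connected.
exists (connected_component (ball x0 rho `&` Om) y); last exact: filterS UD.
split; first by exists y => //; exact: GOB.
(* Members of [U] meet each other, and the neighbourhoods of [x0] are among them. *)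
move=> W /U_x0 UW; exact: (filter_ex (filterI (filterS DC UD) UW)).
Qed.

End ultrafilter_at_boundary.

(** * Distances between sets, and ends shrinking to a point *)

Lemma set_dist_lb (R : realType) (X : metricType R) (A B : set X) (a b : X) :
  A a -> B b -> (set_dist A B <= (mdist a b)%:E)%E.
Proof. by move=> Aa Bb; apply: ereal_inf_lbound; exists a => //; exists b. Qed.


Lemma gt0_set_dist (R : realType) (X : metricType R) (A B : set X) (e : R) :
  0 < e -> (forall a b, A a -> B b -> e <= mdist a b) -> (0 < set_dist A B)%E.
Proof.
move=> e0 AB; apply: (@lt_le_trans _ _ e%:E); first by rewrite lte_fin.
by apply: le_ereal_inf_tmp => _ [a Aa [b Bb <-]]; rewrite lee_fin; exact: AB.
Qed.

Lemma open_ball_metric (R : realType) (X : metricType R) (x : X) (e : R) :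
  open (ball x e).
Proof.
rewrite openE => y; rewrite ballEmdist/= -subr_gt0 => xy.
apply/nbhs_ballP; exists (e - mdist x y) => //= z; rewrite !ballEmdist/= => yz.
have := metric_triangle x y z; lra.
Qed.

Lemma closure_ball_le (R : realType) (X : metricType R) (x y : X) (e : R) :
  closure (ball x e) y -> mdist x y <= e.
Proof.
move=> cly; apply/ler_addgt0Pl => d d0.
have [z []] := cly _ (nbhsx_ballx y _ d0).
rewrite !ballEmdist/= => xz yz.
rewrite addrC (le_trans (metric_triangle x z y))// lerD ?ltW//.
by rewrite metric_sym.
Qed.

Lemma equivalent_chains_class (R : realType) (X : metricType R) (Om : set X)
    (E F : nat -> set X) :
  equivalent_chains E F -> end_class Om E = end_class Om F.
Proof.
have dtrans (A B C : nat -> set X) : divides A B -> divides B C -> divides A C.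
  move=> AB BC k; have [l BlCk] := BC k; have [m AmBl] := AB l.
  by exists m; exact: subset_trans BlCk.
move=> [EF FE]; apply/seteqP; split => G [chG [dG Gd]]; split => //.
  by split; [exact: dtrans dG|exact: dtrans EF].
by split; [exact: dtrans dG|exact: dtrans FE].
Qed.

Lemma decr_subset (T : Type) (E : nat -> set T) :
  (forall k, E k.+1 `<=` E k) ->
  forall n m, (n <= m)%N -> E m `<=` E n.
Proof.
move=> Edecr n; elim=> [|m IHm]; first by rewrite leqn0 => /eqP ->.
by rewrite leq_eqVlt => /orP[/eqP ->//|/IHm]; exact: subset_trans.
Qed.

Lemma prime_end_shrinking_balls (R : realType) (X : metricType R) (Om : set X)
    (x0 : X) (F : nat -> set X) (r : nat -> R) :
  chain Om F -> (forall k, F k `<=` ball x0 (r k)) ->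
  r k @[k --> \oo] --> (0 : R) -> prime_end Om (end_class Om F).
Proof.
move=> chF Fr r0; split; first by exists F.
move=> _ [E chE ->] /(_ E F) EdF; apply: equivalent_chains_class.
have divE : divides E F.
  by apply: EdF; split => //; split => k; exists k.
(* It remains to see that [F] divides [E]; suppose that no [F l] lies in [E k]. *)
split => // k; apply: contrapT => nF.
have [aE Edecr Edist _] := chE; have [aF _ _ _] := chF.
have Esub := decr_subset Edecr.
have En0 n : E n !=set0.
  have [_ _ _ [z [clz _]]] := aE n.
  by have [w [Ew _]] := clz _ filterT; exists w.
(* With [m] given by division, the nonempty set [E (maxn n m)] lies in both [F l] and [E n]. *)
have meets l n : F l `&` E n !=set0.
  have [m EF] := divE l; have [w Ew] := En0 (maxn n m); exists w.
  split; last by apply: Esub Ew; exact: leq_maxl.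
  by apply: EF; apply: Esub Ew; exact: leq_maxr.
have bd l n : (k <= n)%N -> exists2 w, (Om `&` boundary (E n)) w & mdist x0 w < r l.
  move=> kn; have [_ cF [FOm _] _] := aF l.
  have [|w [Fw bw]] := connected_meets_boundary cF (meets l n).
    by move=> FE; apply: nF; exists l; exact: subset_trans (Esub _ _ kn).
  exists w; first by split => //; exact: FOm.
  by move: (Fr l _ Fw); rewrite ballEmdist.
suff : (set_dist (Om `&` boundary (E k.+1)) (Om `&` boundary (E k)) <= 0)%E.
  by rewrite leNgt Edist.
apply/lee_addgt0Pr => e e0; rewrite add0e.
have e20 : 0 < e / 2 by rewrite divr_gt0.
have /cvgrPdist_lt/(_ _ e20)[l _ /(_ l (leqnn l))/=] := r0.
rewrite sub0r normrN => /ltr_normlW rl.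
(* Both boundary points are within [r l < e / 2] of [x0], through which the triangle inequality
   passes. *)
have [v bv xv] := bd l _ (leqnSn k); have [w bw xw] := bd l _ (leqnn k).
apply: (le_trans (set_dist_lb bv bw)); rewrite lee_fin.
rewrite (le_trans (metric_triangle v x0 w))// (splitr e) lerD//.
  by rewrite metric_sym ltW// (lt_trans xv).
by rewrite ltW// (lt_trans xw).
Qed.

(** * Construction of the prime end *)

Lemma prime_end_in_decreasing_sets (R : realType) (X : metricType R)
    (Om : set X) (x0 : X) (A : nat -> set X) (r : nat -> R) :
  locally_quasiconnected X -> open Om -> boundary Om x0 ->
  finitely_connected_at Om x0 ->
  (forall k, A k `<` Om) -> (forall k, A k.+1 `<=` A k) ->
  (forall k, closure (A k) x0) ->
  (forall k, r k.+1 < r k) -> r k @[k --> \oo] --> (0 : R) ->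
  (forall k, 0 < r k) ->
  (forall k, ((r k)%:E < set_dist [set x0] (Om `&` boundary (A k)))%E) ->
  exists F : nat -> set X,
    [/\ chain Om F, prime_end Om (end_class Om F), impression F = [set x0],
        forall k, components_at Om x0 (r k) (F k) & forall k, F k `<=` A k].
Proof.
move=> lqc oOm bx0 fcx0 A_proper A_decr A_closure r_decr r_cvg r_gt0 r_lt.
have Asub := decr_subset A_decr.
have AOm k : A k `<=` Om by case: (A_proper k).
(* The filter generated by the neighbourhoods of [x0] and the sets [A k]; it is proper because [x0]
   is in every [closure (A k)]. *)
pose B : set (set X) := [set W | exists k V, nbhs x0 V /\ V `&` A k `<=` W].
have BF : ProperFilter B.
  split.
    move=> [k [V [Vx0 VA]]]; have [z [Az Vz]] := A_closure k _ Vx0.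
    exact: (VA z).
  split.
  - by exists 0%N, setT; split => //; exact: filterT.
  - move=> P Q [k [V [nV VP]]] [l [W [nW WQ]]]; exists (maxn k l), (V `&` W).
    split; first exact: filterI.
    move=> z [[Vz Wz] Az]; split; [apply: VP|apply: WQ]; split => //.
      by apply: Asub Az; exact: leq_maxl.
    by apply: Asub Az; exact: leq_maxr.
  - move=> P Q PQ [k [V [nV VP]]]; exists k, V; split => //.
    exact: subset_trans PQ.
(* Using one ultrafilter for all [k] makes the choices of components compatible. *)
have [U [U_ultra BU]] := ultraFilterLemma BF.
have U_x0 : nbhs x0 `<=` U.
  by move=> V nV; apply: BU; exists 0%N, V; split => //; exact: subIsetl.
have UA k : U (A k).
  by apply: BU; exists k, setT; split; [exact: filterT|exact: subIsetr].
have UOm : U Om by exact: filterS (AOm 0%N) (UA 0%N).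
have [F FP] : exists F : nat -> set X,
    forall k, components_at Om x0 (r k) (F k) /\ U (F k).
  suff /choice[F FP] : forall k, exists C, components_at Om x0 (r k) C /\ U C.
    by exists F.
  move=> k; have [C C1 C2] := ultra_component_at U_ultra U_x0 (r_gt0 k) UOm fcx0.
  by exists C.
have Fcomp k z : F k z -> F k = connected_component (ball x0 (r k) `&` Om) z.
  by have [[[y _ <-] _] _] := FP k; exact: same_connected_component.
have FBOm k : F k `<=` ball x0 (r k) `&` Om.
  by have [[[y _ <-] _] _] := FP k; exact: connected_component_sub.
have FB k : F k `<=` ball x0 (r k) by move=> z /FBOm[].
have FOm k : F k `<=` Om by move=> z /FBOm[].
have Fcon k : connected (F k).
  by have [[[y _ <-] _] _] := FP k; exact: component_connected.
have UF k : U (F k) by case: (FP k).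
have Fx0 k : closure (F k) x0 by case: (FP k) => -[].
(* Both sets belong to [U], hence meet; the connected set [F k.+1] lies in the larger ball, so it
   stays in the component [F k]. *)
have Fdecr k : F k.+1 `<=` F k.
  have [z [F1z Fz]] := filter_ex (filterI (UF k.+1) (UF k)).
  rewrite (Fcomp _ _ Fz); apply: connected_component_max => //.
  apply: (subset_trans (FBOm _)); apply: setSI; apply: le_ball.
  exact: ltW.
(* Otherwise [F k] would meet the boundary of [A k] at a point of [Om] closer to [x0] than [r k]. *)
have FA k : F k `<=` A k.
  apply: contrapT => nFA.
  have [w [Fw bw]] := connected_meets_boundary (Fcon k)
    (filter_ex (filterI (UF k) (UA k))) nFA.
  have := r_lt k; rewrite ltNge => /negP; apply.
  have bw' : (Om `&` boundary (A k)) w by split => //; exact: FOm Fw.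
  apply: (le_trans (set_dist_lb (erefl : [set x0] x0) bw')).
  by rewrite lee_fin ltW//; have := FB _ _ Fw; rewrite ballEmdist.
(* Components being open, a point of [Om] inside the ball and in the closure of [F k] has a
   component meeting [F k], hence equal to it, and is interior to [F k]. *)
have bF_ge k w : (Om `&` boundary (F k)) w -> r k <= mdist x0 w.
  move=> [Omw [clw niw]]; rewrite leNgt; apply/negP => xw.
  pose C := connected_component (ball x0 (r k) `&` Om) w.
  have nC : nbhs w C.
    apply: open_nbhs_nbhs; split; last first.
      by apply: connected_component_refl; split => //; rewrite ballEmdist.
    apply: open_connected_component => //; apply: openI => //.
    exact: open_ball_metric.
  have [z [Fz Cz]] := clw _ nC; apply: niw.
  by rewrite (Fcomp _ _ Fz) -(same_connected_component Cz).
have bF_le k w : boundary (F k) w -> mdist x0 w <= r k.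
  by move=> [clw _]; apply: closure_ball_le; exact: closureS clw.
have Fimp : impression F = [set x0].
  apply/seteqP; split => [z Fz|_ -> k _ //].
  apply/esym/mdist_positivity/eqP; rewrite eq_le mdist_ge0 andbT.
  apply/ler_addgt0Pr => e e0; rewrite add0r.
  have /cvgrPdist_lt/(_ _ e0)[l _ /(_ l (leqnn l))/=] := r_cvg.
  rewrite sub0r normrN => /ltr_normlW rl.
  apply: le_trans (ltW rl); apply: closure_ball_le.
  by apply: closureS (Fz l _) => //; exact: FB.
have chF : chain Om F.
  split => // [k|k|]; last by rewrite Fimp => _ ->.
    split => //.
    - by exists x0, (r k).
    - split => // OmF; have [_] := A_proper k; apply.
      exact: subset_trans (FA k).
    - by exists x0.
  (* The boundary of [F k.+1] stays within [r k.+1] of [x0], while that of [F k] in [Om] is at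
     distance at least [r k]. *)
  apply: (@gt0_set_dist _ _ _ _ (r k - r k.+1)); first by rewrite subr_gt0.
  move=> a b [_ /bF_le xa] /bF_ge xb.
  have := metric_triangle x0 a b; lra.
by exists F; split => //; [exact: prime_end_shrinking_balls chF FB r_cvg|
  move=> k; case: (FP k)].
Qed.

(** * Upper gradients along arc length curves *)

Section upper_gradients.
Context {R : realType} {X : completeMetricType R}.

Lemma open_measurable_borel (S : set X) :
  open S -> measurable (S : set (borel X)).
Proof. by move=> oS; exact: sub_sigma_algebra. Qed.

Lemma continuous_measurable_borel (f : X -> R) :
  continuous f -> measurable_fun setT (f : borel X -> R).
Proof.
move=> cf; apply: (measurability _ (RGenOpens.measurableE R)).
move=> _ [_ [a [b ->]] <-]; rewrite setTI; apply: open_measurable_borel.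
by apply: open_comp => // y _; exact: cf.
Qed.

(** The partition of [[s, t]] without interior points already bounds the length [t - s] from
    below. *)
Lemma arclength_curve_mdist (l : R) (gam : R -> X) (s t : R) :
  arclength_curve l gam -> 0 <= s -> s <= t -> t <= l ->
  mdist (gam s) (gam t) <= t - s.
Proof.
move=> [_ _ len] s0; rewrite le_eqVlt => /orP[/eqP <-|st] tl.
  by rewrite mdistxx subrr.
rewrite -lee_fin -(len _ _ s0 (ltW st) tl); apply: ereal_sup_ubound => /=.
exists [:: t]; first exact: itv_partition1.
by rewrite /curve_variation/= big_nat1.
Qed.

Lemma measurable_curve_indic (l : R) (gam : R -> X) (S : set X) :
  {within `[0, l], continuous gam} -> open S ->
  measurable_fun `[0, l] (EFin \o (\1_S : X -> R) \o gam).
Proof.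
move=> cgam oS.
have mS : measurable (`[0, l]%classic `&` gam @^-1` S).
  apply: open_measurable_subspace => //.
  by apply: open_comp => // t _; exact: cgam.
apply: (eq_measurable_fun
  (EFin \o (\1_(`[0, l]%classic `&` gam @^-1` S) : R -> R))) => [t|].
  by rewrite inE => tl /=; rewrite !indicE in_setI mem_set.
by apply/measurable_EFinP; exact: measurable_indic.
Qed.

(** Continuous induction: the local estimate at the supremum of the good parameters carries the
    bound past that supremum, unless it is [l]. *)
Lemma local_to_global_increment (h : R -> R) (f : R -> \bar R) (l : R) :
  0 <= l -> measurable_fun `[0, l] f -> (forall t, 0 <= f t)%E ->
  (forall t : R, 0 <= t <= l -> exists2 d : R, 0 < d & forall a b : R,
    0 <= a -> a <= b -> b <= l -> `|a - t| < d -> `|b - t| < d ->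
    (`|h a - h b|%:E <= \int[lebesgue_measure]_(x in `[a, b]) f x)%E) ->
  (`|h 0 - h l|%:E <= \int[lebesgue_measure]_(x in `[0%R, l]) f x)%E.
Proof.
move=> l0 mf f0 loc.
pose S := [set t : R | 0 <= t <= l /\
  (`|h 0 - h t|%:E <= \int[lebesgue_measure]_(x in `[0%R, t]) f x)%E].
have S0 : S 0.
  split; first by rewrite lexx.
  by rewrite subrr normr0; apply: integral_ge0 => x _.
have ubS : ubound S l by move=> t [/andP[]].
have supS : has_sup S by split; [exists 0|exists l].
have c0l : 0 <= sup S <= l.
  by rewrite ub_le_sup//=; [apply: ge_sup => //; exists 0|exists l].
have [d d0 dP] := loc _ c0l.
have [s Ss scd] := sup_adherent d0 supS.
have sc : s <= sup S by apply: ub_le_sup => //; exists l.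
have [/andP[s0 sl] Is] := Ss.
(* Beyond [sup S] but still within reach of the local estimate, and capped at [l]. *)
pose t := Num.min l (sup S + d / 2).
have ct : sup S <= t by rewrite le_min; case/andP: c0l => _ ->/=; lra.
have tl : t <= l by rewrite ge_min lexx.
have td : t <= sup S + d / 2 by rewrite ge_min lexx orbT.
have st : s <= t by exact: le_trans ct.
have St : S t.
  split; first by rewrite tl (le_trans s0 st).
  have -> : h 0 - h t = (h 0 - h s) + (h s - h t) by lra.
  apply: (@le_trans _ _ (`|h 0 - h s|%:E + `|h s - h t|%:E)%E).
    by rewrite -EFinD lee_fin ler_normD.
  rewrite (_ : `[0, t]%classic = `[0, s] `|` `]s, t]); last first.
    by rewrite -itv_bndbnd_setU// bnd_simp.
  have m0t : measurable_fun `[0, t] f.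
    apply: measurable_funS mf => //; apply: subset_itvl.
    by rewrite bnd_simp.
  have E0t : `[0, t]%classic = `[0, s] `|` `]s, t].
    by rewrite -itv_bndbnd_setU// bnd_simp.
  rewrite ge0_integral_setU//=; last 2 first.
  - by rewrite -E0t.
  - apply/disj_setPS => x [] /=; rewrite !in_itv/= => /andP[_ xs] /andP[sx _].
    by move: (lt_le_trans sx xs); rewrite ltxx.
  apply: leeD => //; rewrite integral_itv_obnd_cbnd; last first.
    by apply: measurable_funS m0t => //; rewrite E0t; exact: subsetUr.
  apply: dP => //.
    by rewrite ltr_norml; apply/andP; split; lra.
  by rewrite ltr_norml; apply/andP; split; lra.
(* As [t] belongs to [S], it cannot pass [sup S], so the cap is attained and [t] is [l]. *)
have : t <= sup S by apply: ub_le_sup => //; exists l.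
rewrite ge_min => /orP[lS|]; last by rewrite gerDl leNgt divr_gt0.
suff -> : l = t by case: St.
by apply/esym/min_idPl; rewrite (le_trans lS)// lerDl divr_ge0// ltW.
Qed.

(** Where [u] is locally constant there is no increment to pay for. Elsewhere the curve runs inside
    [S], where the integral over [[a, b]] is [b - a], at least the distance between the
    endpoints. *)
Lemma upper_gradient_indic (u : X -> R) (S : set X) : open S ->
  (forall z, exists2 d, 0 < d &
    (forall a b, ball z d a -> ball z d b -> u a = u b) \/
    (ball z d `<=` S /\
     forall a b, ball z d a -> ball z d b -> `|u a - u b| <= mdist a b)) ->
  upper_gradient (EFin \o u) (EFin \o \1_S).
Proof.
move=> oS loc; split.
  split=> [y|]; first by rewrite lee_fin.
  apply/measurable_EFinP; apply: measurable_indic.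
  exact: open_measurable_borel.
move=> l gam agam _; rewrite /upper_gradient_ineq/= /curve_integral.
have [l0 cgam _] := agam.
have lip a b := arclength_curve_mdist (s := a) (t := b) agam.
have mS : measurable_fun `[0, l] (EFin \o (\1_S : X -> R) \o gam).
  exact: measurable_curve_indic.
apply: (@local_to_global_increment (u \o gam)) => // [t|t /andP[t0 tl]].
  by rewrite lee_fin.
(* The curve is 1-Lipschitz, so a radius in space also serves as a radius for the parameter. *)
have [d d0 dP] := loc (gam t); exists d => // a b a0 ab bl a_t b_t.
have dist s : 0 <= s -> s <= l -> `|s - t| < d -> ball (gam t) d (gam s).
  move=> s0 sl std; rewrite ballEmdist/=; have [ts|/ltW st] := leP t s.
    apply: le_lt_trans (lip _ _ t0 ts sl) _.
    by rewrite ger0_norm ?subr_ge0 in std.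
  rewrite metric_sym; apply: le_lt_trans (lip _ _ s0 st tl) _.
  by rewrite distrC ger0_norm ?subr_ge0 in std.
have Ba := dist _ a0 (le_trans ab bl) a_t.
have Bb := dist _ (le_trans a0 ab) bl b_t.
case: dP => [uc|[BS ulip]].
  by rewrite /= (uc _ _ Ba Bb) subrr normr0; apply: integral_ge0 => x _; rewrite lee_fin.
apply: (@le_trans _ _ (\int[lebesgue_measure]_(x in `[a, b]) 1)%E).
  rewrite integral_cst//= mul1e lebesgue_measure_itv/= lte_fin.
  have := le_trans (ulip _ _ Ba Bb) (lip _ _ a0 ab bl).
  case: ltP => [_|ba]; first by rewrite -EFinB lee_fin.
  by rewrite lee_fin => /le_trans; apply; lra.
apply: ge0_le_integral => //.
- apply: measurable_funS mS => //.
  by apply: subset_itv; rewrite bnd_simp.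
- move=> x /=; rewrite in_itv/= => /andP[ax xb]; rewrite lee_fin indicE mem_set//.
  apply: BS; apply: dist; [exact: le_trans a0 ax|exact: le_trans xb bl|].
  move: a_t b_t; rewrite !ltr_norml => /andP[? ?] /andP[? ?].
  by apply/andP; split; lra.
Qed.

End upper_gradients.

(** * Lipschitz truncations and the cutoff of a disconnection *)

Lemma maxr_lipschitz (R : realDomainType) (c a b : R) :
  `|Num.max c a - Num.max c b| <= `|a - b|.
Proof.
wlog ab : a b / a <= b => [H|].
  have [|/ltW] := leP a b; first exact: H.
  by move=> ba; rewrite distrC [leRHS]distrC; exact: H.
rewrite distrC [leRHS]distrC !ger0_norm ?subr_ge0//; last first.
  by rewrite ge_max !le_max lexx ab orbT.
by have [] := leP c a; have [] := leP c b; lra.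
Qed.

Lemma minr_lipschitz (R : realDomainType) (c a b : R) :
  `|Num.min c a - Num.min c b| <= `|a - b|.
Proof.
rewrite -(opprK c) -{1}(opprK a) -{1}(opprK b) -!oppr_max -opprD normrN.
apply: le_trans (maxr_lipschitz _ _ _) _.
by rewrite -opprD normrN.
Qed.

Lemma min_max_lipschitz (R : realDomainType) (e c a b : R) :
  `|Num.max 0 (Num.min e (c - a)) - Num.max 0 (Num.min e (c - b))|
    <= `|a - b|.
Proof.
apply: le_trans (maxr_lipschitz _ _ _) _.
apply: le_trans (minr_lipschitz _ _ _) _.
by rewrite opprB addrC addrA subrK distrC.
Qed.

Lemma mdist_lipschitz (R : realType) (X : metricType R) (x a b : X) :
  `|mdist x a - mdist x b| <= mdist a b.
Proof.
rewrite ler_norml; have := metric_triangle x a b; have := metric_triangle x b a.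
by rewrite (metric_sym b a) => *; apply/andP; split; lra.
Qed.

(** A nonempty open set contains a ball, which has positive measure and fits in no null set. *)
Lemma ae_open_ex (R : realType) (X : completeMetricType R)
    (mu : {measure set (borel X) -> \bar R}) (P : set X) (V : set X) :
  (forall (x : X) (e : R), 0 < e -> (0 < mu (ball x e))%E) ->
  open V -> V !=set0 -> {ae mu, forall x, P x} -> V `&` P !=set0.
Proof.
move=> mu_gt0 oV [x Vx] [N [mN N0 PN]]; apply: contrapT => /nonemptyPn VP0.
have /nbhs_ballP[e /= e0 eV] : nbhs x V by exact: open_nbhs_nbhs.
have := mu_gt0 x e e0; rewrite ltNge => /negP; apply; rewrite -N0.
apply: le_measure; rewrite ?inE//.
  by apply: open_measurable_borel; exact: open_ball_metric.
move=> y /eV Vy; apply: PN => Py.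
by have : (V `&` P) y by []; rewrite VP0.
Qed.

Section cutoff.
Context (R : realType) (X : completeMetricType R).
Variables (x : X) (e : R) (V : set X).

(* Equal to e on V near x, to 0 on the other half of a disconnection of the ball
   of radius 4 e, and locally constant outside the annulus e < d(x, .) < 4 e. *)
Definition split_cutoff (y : X) : R :=
  \1_V y * Num.max 0 (Num.min e (3 * e - mdist x y)).

Definition annulus : set X := [set y | e < mdist x y < 4 * e].

Lemma open_annulus : open annulus.
Proof.
rewrite openE => y /andP[ey y4]; apply/nbhs_ballP.
exists (Num.min (mdist x y - e) (4 * e - mdist x y)) => /=.
  by rewrite lt_min !subr_gt0 ey.
move=> z; rewrite ballEmdist/= lt_min => /andP[yz1 yz2].
have := mdist_lipschitz x y z; rewrite ler_norml => /andP[? ?].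
by apply/andP; split; lra.
Qed.

Hypothesis e_gt0 : 0 < e.

Lemma split_cutoff_ge0 y : 0 <= split_cutoff y.
Proof. by rewrite mulr_ge0// le_max lexx. Qed.

Lemma split_cutoff_far y : 3 * e <= mdist x y -> split_cutoff y = 0.
Proof.
move=> xy; rewrite /split_cutoff max_l ?mulr0//.
by rewrite ge_min; apply/orP; right; lra.
Qed.

Lemma split_cutoff_le y : split_cutoff y <= e * \1_(ball x (4 * e)) y.
Proof.
have [y4|y4] := ltP (mdist x y) (4 * e); last first.
  rewrite split_cutoff_far; first by rewrite mulr_ge0// ltW.
  by apply: le_trans y4; rewrite ler_pM2r// ler_nat.
rewrite indicE mem_set ?ballEmdist// mulr1 /split_cutoff.
apply: (@le_trans _ _ (1 * Num.max 0 (Num.min e (3 * e - mdist x y)))).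
  by apply: ler_wpM2r; [rewrite le_max lexx|rewrite indicE; case: (_ \in _)].
by rewrite mul1r ge_max ltW//= ge_min lexx.
Qed.

Lemma split_cutoff_near y : V y -> mdist x y < 2 * e -> split_cutoff y = e.
Proof.
move=> Vy xy; rewrite /split_cutoff indicE mem_set// mul1r.
by rewrite min_l; [rewrite max_r// ltW|lra].
Qed.

Lemma split_cutoff_out y : ~ V y -> split_cutoff y = 0.
Proof. by move=> nVy; rewrite /split_cutoff indicE memNset// mul0r. Qed.

Lemma measurable_split_cutoff : open V ->
  measurable_fun setT (split_cutoff : borel X -> R).
Proof.
move=> oV; apply: measurable_funM.
  by apply: measurable_indic; exact: open_measurable_borel.
apply: continuous_measurable_borel => y; apply/cvgrPdist_lt => d d0.
apply/nbhs_ballP; exists d => //= z; rewrite ballEmdist/=; apply: le_lt_trans.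
exact: le_trans (min_max_lipschitz e _ _ _) (mdist_lipschitz x _ _).
Qed.

(** The indicator of [V] creates no jump: the boundary of [V] avoids [ball x (4 * e)], and the
    radial factor vanishes from distance [3 * e] on. *)
Lemma upper_gradient_split_cutoff (W : set X) :
  open V -> open W -> V `&` W = set0 -> ball x (4 * e) `<=` V `|` W ->
  upper_gradient (EFin \o split_cutoff) (EFin \o \1_annulus).
Proof.
move=> oV oW VW VWB; apply: upper_gradient_indic; first exact: open_annulus.
have WnV y : W y -> ~ V y by move=> Wy Vy; have : (V `&` W) y by []; rewrite VW.
move=> z.
have [z4|z4] := leP (4 * e) (mdist x z).
  exists e => //; left => a b; rewrite ballEmdist/= => za zb.
  rewrite !split_cutoff_far//.
    have := metric_triangle x b z; rewrite (metric_sym b z); lra.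
  have := metric_triangle x a z; rewrite (metric_sym a z); lra.
have Bz : ball x (4 * e) z by rewrite ballEmdist.
have [Vz|Wz] := VWB _ Bz; last first.
  have /nbhs_ballP[d /= d0 dW] : nbhs z W by exact: open_nbhs_nbhs.
  exists d => //; left => a b /dW/WnV Va /dW/WnV Vb.
  by rewrite !split_cutoff_out.
have [z2|z2] := ltP (mdist x z) (2 * e).
  have /nbhs_ballP[d /= d0 dV] : nbhs z (V `&` ball x (2 * e)).
    apply: open_nbhs_nbhs; split; last by split => //; rewrite ballEmdist.
    by apply: openI => //; exact: open_ball_metric.
  exists d => //; left => a b /dV[Va +] /dV[Vb +].
  by rewrite ballEmdist/= => xa xb; rewrite !split_cutoff_near.
(* Starting at [e] rather than [2 * e], the open annulus also surrounds the points at distance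
   exactly [2 * e]. *)
have /nbhs_ballP[d /= d0 dV] : nbhs z (V `&` annulus).
  apply: open_nbhs_nbhs; split; first by apply: openI => //; exact: open_annulus.
  by split => //; apply/andP; split => //; lra.
exists d => //; right; split=> [y /dV[]//|a b /dV[Va _] /dV[Vb _]].
rewrite /split_cutoff !indicE !mem_set// !mul1r.
exact: le_trans (min_max_lipschitz e _ _ _) (mdist_lipschitz x _ _).
Qed.

End cutoff.

(** * From the Poincare inequality to local quasiconnectedness *)

Section poincare_connectedness.
Context (R : realType) (X : completeMetricType R).
Variables (mu : {measure set (borel X) -> \bar R}) (p : R).
Hypothesis mu_ball : forall (x : X) (r : R), 0 < r -> (0 < mu (ball x r) < +oo)%E.
Hypothesis p_gt0 : 0 < p.

Lemma p_energy_indic (S : set X) : open S ->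
  p_energy mu p (EFin \o \1_S) = mu S.
Proof.
move=> oS; have mS := open_measurable_borel oS.
rewrite -[mu S]/(mu (S : set (borel X))) -[S in RHS]setIT.
rewrite -(integral_indic mu measurableT mS).
apply: eq_integral => y _ /=; rewrite indicE; case: (_ \in _) => /=.
  by rewrite powR1.
by rewrite powR0// gt_eqF.
Qed.

Lemma upper_gradient_weak (u g : borel X -> \bar R) :
  upper_gradient u g -> weak_upper_gradient mu p u g.
Proof.
move=> [ng ug]; split => //; exists (fun _ _ => False).
  exists (cst 0%E); split; [by split| |by []].
  by rewrite /p_energy integral0_eq// => y _; rewrite poweR0r// gt_eqF.
by move=> l gam agam ngam _; exact: ug.
Qed.

Lemma poincare_locally_quasiconnected :
  poincare mu p -> locally_quasiconnected X.
Proof.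
move=> [C [lam [C0 lam1 PI]]] x e0 e0_gt0.
have lam0 : 0 < lam by lra.
(* The cap at 1 keeps the [p]-th power of the cutoff below the indicator of [ball x (4 * e)]; the
   factor 4 fits that ball into [ball x e0]. *)
pose e := Num.min 1 (e0 / 4).
have e_gt0 : 0 < e by rewrite lt_min ltr01/= divr_gt0.
have e1 : e <= 1 by rewrite ge_min lexx.
have e4 : 4 * e <= e0.
  have : e <= e0 / 4 by rewrite ge_min lexx orbT.
  lra.
(* The ball enlarged by [lam] becomes [ball x e], which the annulus avoids. *)
pose d := e / lam; have d_gt0 : 0 < d by rewrite divr_gt0.
have lamd : lam * d = e by rewrite mulrC divfK// gt_eqF.
have d_le : d <= e by rewrite ler_pdivrMr// ler_peMr// ltW.
exists d => // V W oV oW VW VWB Vx z dz; apply: contrapT => nVz.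
pose u : borel X -> R := split_cutoff x e V.
have VWB4 : ball x (4 * e) `<=` V `|` W.
  by apply: subset_trans VWB; exact: le_ball.
have Wz : W z.
  have [] // := VWB4 z; apply: le_ball dz; lra.
pose g : borel X -> \bar R := EFin \o \1_(annulus x e).
have ug : upper_gradient (EFin \o u) g by exact: upper_gradient_split_cutoff VWB4.
have mball y r : measurable (ball y r : set (borel X)).
  by apply: open_measurable_borel; exact: open_ball_metric.
have mB4 : (mu (ball x (4 * e)) < +oo)%E.
  have e40 : 0 < 4 * e by rewrite mulr_gt0.
  by case/andP: (mu_ball x e40).
have Eg : (p_energy mu p g < +oo)%E.
  rewrite p_energy_indic; last exact: open_annulus.
  apply: le_lt_trans mB4; apply: le_measure; rewrite ?inE//.
    by apply: open_measurable_borel; exact: open_annulus.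
  by move=> y /andP[_]; rewrite ballEmdist.
have meas_u : measurable_fun setT u by exact: measurable_split_cutoff.
have Nu : newtonian mu p (EFin \o u).
  split; first exact/measurable_EFinP.
  apply: lte_add_pinfty; last first.
    by apply: le_lt_trans Eg; apply: ereal_inf_lbound; exists g.
  apply: le_lt_trans mB4.
  rewrite -[ball x (4 * e)]setIT -(integral_indic mu measurableT (mball _ _)).
  apply: ge0_le_integral => //.
  - by move=> y _; exact: poweR_ge0.
  - apply: (measurableT_comp (measurable_poweR p)); apply: measurableT_comp => //.
    exact/measurable_EFinP.
  - exact/measurable_EFinP/measurable_indic.
  - move=> y _ /=; rewrite lee_fin ger0_norm ?split_cutoff_ge0//.
    have := split_cutoff_le x V e_gt0 y; rewrite indicE; case: (y \in _) => /=.
      rewrite mulr1 => uy; apply: (@le_trans _ _ (powR 1 p)); last by rewrite powR1.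
      apply: ge0_ler_powR; rewrite ?nnegrE ?split_cutoff_ge0//; first exact: ltW.
      exact: le_trans e1.
    rewrite mulr0 => u0; rewrite (_ : u y = 0); first by rewrite powR0// gt_eqF.
    by apply/eqP; rewrite eq_le u0 split_cutoff_ge0.
have [gu [[[gu0 mgu] _] Egu guP]] := PI x d d_gt0 _ Nu.
have {}guP : {ae mu, forall y, (gu y <= g y)%E}.
  by apply: guP => //; exact: upper_gradient_weak.
(* The right-hand side vanishes: [gu] is almost everywhere at most [g], which is zero on
   [ball x e]. *)
rewrite lamd (_ : mean _ _ (fun y => gu y `^ p)%E = 0%E); last first.
  rewrite /mean (_ : (\int[mu]_(y in ball x e) _)%E = 0%E) ?mule0//.
  apply/eqP; rewrite eq_le; apply/andP; split; last first.
    by apply: integral_ge0 => y _; exact: poweR_ge0.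
  apply: (@le_trans _ _ (\int[mu]_(y in ball x e) (g y `^ p))%E).
    apply: ae_ge0_le_integral => //.
    - by move=> y _; exact: poweR_ge0.
    - apply: measurable_funTS; exact: (measurableT_comp (measurable_poweR p)).
    - by move=> y _; exact: poweR_ge0.
    - apply: measurable_funTS; apply: (measurableT_comp (measurable_poweR p)).
      by case: ug => -[].
    - apply: filterS guP => y gy _.
      apply: gt0_ler_poweR; rewrite ?in_itv/= ?leey ?andbT//; first exact: ltW.
      by rewrite lee_fin.
  rewrite integral0_eq// => y; rewrite ballEmdist/= => xy.
  rewrite /g/= indicE memNset ?powR0 ?gt_eqF//.
  by move=> /andP[]; rewrite ltNge ltW.
rewrite poweR0r ?invr_neq0 ?gt_eqF// mule0.
move: (mean mu (ball x d) (EFin \o u)) => m.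
rewrite /mean; have /andP[B0 Boo] := mu_ball x d_gt0.
rewrite pmule_rle0; last by rewrite lte_fin invr_gt0 fine_gt0// B0.
move=> I0.
have : (\int[mu]_(y in ball x d) `|(u y)%:E - m| = 0)%E.
  apply/eqP; rewrite eq_le; apply/andP; split; first exact: I0.
  exact: integral_ge0.
move=> /(ae_eq_integral_abs _ (mball x d)) H.
have {H} ae0 : {ae mu, forall y, ball x d y -> ((u y)%:E - m = 0)%E}.
  apply: H; apply: measurable_funTS; apply: emeasurable_funB => //.
  exact/measurable_EFinP.
have oB := open_ball_metric x d.
have muB y r : 0 < r -> (0 < mu (ball y r))%E by move=> /(mu_ball y)/andP[].
(* In [ball x d] the cutoff is [e] on [V] and 0 on [W]. Both parts are open and nonempty, so the
   almost everywhere constant value [m] would equal both. *)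
have [y1 [[Vy1 By1] /(_ By1)]] := ae_open_ex muB (openI oV oB)
  (ex_intro _ x (conj Vx (ballxx x d_gt0))) ae0.
have [y2 [[Wy2 By2] /(_ By2)]] := ae_open_ex muB (openI oW oB)
  (ex_intro _ z (conj Wz dz)) ae0.
rewrite /u split_cutoff_out; last first.
  by move=> Vy2; have : (V `&` W) y2 by []; rewrite VW.
rewrite split_cutoff_near//; last by move: By1; rewrite ballEmdist/=; lra.
by case: (m) => [s| |]//= [m0] [me]; lra.
Qed.

End poincare_connectedness.

Theorem lemma10p6 (R : realType) (X : completeMetricType R)
    (mu : {measure set (borel X) -> \bar R}) (p : R)
    (X_nontrivial : exists x y : X, x <> y)
    (mu_ball : forall (x : X) (r : R), 0 < r -> (0 < mu (ball x r) < +oo)%E)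
    (p_ge1 : 1 <= p)
    (mu_doubling : doubling mu)
    (X_poincare : poincare mu p)
    (Om : set X) (Om_domain : bounded_domain Om) (Om_proper : Om `<` setT)
    (x0 : X) (x0_boundary : boundary Om x0)
    (x0_fin_conn : finitely_connected_at Om x0)
    (A : nat -> set X)
    (A_proper : forall k, A k `<` Om)
    (A_decr : forall k, A k.+1 `<=` A k)
    (A_closure : forall k, closure (A k) x0)
    (A_dist : forall k, (0 < set_dist [set x0] (Om `&` boundary (A k)))%E)
    (r : nat -> R)
    (r_decr : forall k, r k.+1 < r k)
    (r_cvg : r k @[k --> \oo] --> (0 : R))
    (r_gt0 : forall k, 0 < r k)
    (r_lt_dist : forall k,
      ((r k)%:E < set_dist [set x0] (Om `&` boundary (A k)))%E) :
  exists F : nat -> set X,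
    [/\ chain Om F,
        prime_end Om (end_class Om F),
        impression F = [set x0],
        forall k, components_at Om x0 (r k) (F k)
      & forall k, F k `<=` A k].
Proof.
have [_ _ _ oOm] := Om_domain.
have p_gt0 : 0 < p by exact: lt_le_trans p_ge1.
apply: prime_end_in_decreasing_sets => //.
exact: poincare_locally_quasiconnected mu_ball p_gt0 X_poincare.
Qed.
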